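(* Let $a$ be an integer with $a\neq 0,\pm1$. For $m,n\in\mathbb{Z}^+$ and $k\in\mathbb{Z}$ write $$W_{n}(k,m)=\sum_{\substack{1\le l\le m\\ (l,m)=1}}\zeta_m^{-kl}(1+a\zeta_m^l)^n,$$ and $$A_{m}(x)=\prod_{\substack{1\le l\le m\\ (l,m)=1}}(x-1-a\zeta_m^l)=\sum_{s=0}^{\varphi(m)}b_sx^s.$$ Then for all $m,n\in\mathbb{Z}^+$ and $k\in\mathbb{Z}$, $$A_{m}(x)\in \mathbb{Z}[x]\quad\text{and}\quad \sum_{s=0}^{\varphi(m)}b_sW_{n+s}(k,m)=0.$$ Moreover, for any $r\in\mathbb{Z}$, $$\left[\begin{array}{c}n\\ r\end{array}\right]_{m}(a)=\frac1m\sum_{d\mid m}W_{n}(r,d),$$ where the sum runs over the positive divisors $d$ of $m$.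
   Context: $\zeta_m=e^{2\pi i/m}$, $\varphi$ is Euler's totient function, and $(l,m)$ is the greatest common divisor (so for $m=1$ the index set is $\{l=1\}$). For integers $n,m,r$ with $n>0$, $m>0$, define $$\left[\begin{array}{c}n\\ r\end{array}\right]_{m}(a):=\sum_{\substack{0\le k\le n\\ k\equiv r\ (\mathrm{mod}\ m)}}\binom nk a^k .$$ *)

(* Defs.v *)
From mathcomp Require Import all_boot all_order all_algebra.
From mathcomp Require Import reals trigo.
From mathcomp Require Import complex.

Set Implicit Arguments.
Unset Strict Implicit.
Unset Printing Implicit Defensive.

Import Order.TTheory GRing.Theory Num.Theory.
Local Open Scope ring_scope.

(* exp (2 pi i / m), written by Euler's formula; R[i] is the field of complex
   numbers over the reals R. *)
Definition zeta (R : realType) (m : nat) : R[i] :=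
  let t := 2 * pi / m%:R in Complex (cos t) (sin t).

(* The exponent -kl is an integer, so [^] below is [exprz]. *)
Definition W (R : realType) (a : int) (n : nat) (k : int) (m : nat) : R[i] :=
  \sum_(1 <= l < m.+1 | coprime l m)
     zeta R m ^ (- (k * l%:Z)) * (1 + a%:~R * zeta R m ^+ l) ^+ n.

Definition A (R : realType) (a : int) (m : nat) : {poly R[i]} :=
  \prod_(1 <= l < m.+1 | coprime l m)
     ('X - 1 - (a%:~R * zeta R m ^+ l)%:P).

Definition binom_res_sum (n : nat) (r : int) (m : nat) (a : int) : int :=
  \sum_(0 <= k < n.+1 | (k%:Z == r %[mod m%:Z])%Z) 'C(n, k)%:Z * a ^+ k.

(* Main.v *)
Require Import Defs.
From mathcomp Require Import all_boot all_order all_algebra.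
From mathcomp Require Import reals trigo.
From mathcomp Require Import complex.
From mathcomp Require Import ring lra.
Set Implicit Arguments.
Unset Strict Implicit.
Unset Printing Implicit Defensive.

(** The key fact is that the m-th roots of unity, grouped by their exact order
    d, are the primitive d-th roots of unity for the divisors d of m: in terms
    of exponents, l = (m/d) j with j <= d coprime to d, where m/d = gcd(l, m).
    Written for an arbitrary commutative monoid ([big_nat_by_gcd],
    [big_zeta_by_order]), it serves once as a product and once as a sum.

    As a product, it turns the factorization of y^m - a^m over the points
    a zeta_m^l, taken at y = X - 1, into
      prod_(d | m) A_d = (X - 1)^m - a^m.
    Integrality of A_m follows by strong induction on m: A_m is the quotient of
    an integral polynomial by the product of the A_d with d a proper divisor of
    m, which is integral and monic, and Euclidean division by a monic
    polynomial stays in Z[X] ([map_poly_int_divisor]).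

    As a sum, it turns the sum of W_n(r, d) over d | m into the sum over all
    l <= m of zeta_m^(-rl) (1 + a zeta_m^l)^n. Expanding the n-th power, the
    term in a^k carries the sum over l of zeta_m^(l(k - r)), which is m or 0
    according to whether m divides k - r ([sum_prim_root_exp]); this is the
    roots-of-unity filter that selects the residue class of r.

    The recurrence only expresses that W_n is a combination of n-th powers of
    roots of A_m: the sum of b_s W_(n+s) is the sum over l of
    zeta_m^(-kl) x_l^n A_m(x_l) with x_l = 1 + a zeta_m^l. *)

Import Order.TTheory GRing.Theory Num.Theory.
Local Open Scope ring_scope.

(** * The numbers zeta_m *)

Lemma de_Moivre (R : realType) (t : R) (k : nat) :
  Complex (cos t) (sin t) ^+ k = Complex (cos (k%:R * t)) (sin (k%:R * t)).
Proof.
elim: k => [|k IHk]; first by rewrite expr0 mul0r cos0 sin0.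
rewrite exprS IHk -[k.+1%:R]natr1 mulrDl mul1r cosD sinD.
by apply/eqP; rewrite eq_complex /=; apply/andP; split; apply/eqP; ring.
Qed.

(** The powers zeta_m^j with 0 < j < m differ from 1 because the half angle
    x = pi j / m lies in ]0, pi[, so that cos (2x) = 1 - 2 sin(x)^2 < 1. *)
Lemma zeta_prim_root (R : realType) (m : nat) :
  (0 < m)%N -> m.-primitive_root (zeta R m).
Proof.
move=> m_gt0; have m_gt0R : 0 < m%:R :> R by rewrite ltr0n.
rewrite /primitive_root_of_unity m_gt0; apply/forallP=> -[j lt_jm] /=.
rewrite unity_rootE de_Moivre; case: (eqVneq j.+1 m) => [->|ne_jm].
  rewrite [m%:R * _]mulrC (divfK (lt0r_neq0 m_gt0R)) mulr_natl.
  by rewrite cos2pi sin2pi eqxx.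
have lt_j1m : (j.+1 < m)%N by rewrite ltn_neqAle ne_jm.
apply/eqP/negbTE; rewrite eq_complex negb_and; apply/orP; left => /=.
set x : R := pi * j.+1%:R / m%:R.
have -> : j.+1%:R * (2 * pi / m%:R) = x *+ 2 by rewrite /x; ring.
have sin_x_gt0 : 0 < sin x.
  apply: sin_gt0_pi; rewrite /x divr_gt0 ?mulr_gt0 ?pi_gt0 //=.
  by rewrite ltr_pdivrMr // ltr_pM2l ?pi_gt0 // ltr_nat.
rewrite cos_mulr2n cos2sin2; apply/eqP => cos1.
by have := exprn_gt0 2 sin_x_gt0; lra.
Qed.

Lemma zeta_dvd (R : realType) (m d : nat) :
  (0 < m)%N -> (d %| m)%N -> zeta R m ^+ (m %/ d) = zeta R d.
Proof.
move=> m_gt0 d_dvd_m; have d_gt0 := dvdn_gt0 m_gt0 d_dvd_m.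
have mE : m%:R = (m %/ d)%:R * d%:R :> R by rewrite -natrM divnK.
have q_neq0 : (m %/ d)%:R != 0 :> R.
  by rewrite pnatr_eq0 -lt0n divn_gt0 // dvdn_leq.
have d_neq0 : d%:R != 0 :> R by rewrite pnatr_eq0 -lt0n.
have angleE : (m %/ d)%:R * (2 * pi / m%:R) = 2 * pi / d%:R :> R.
  by rewrite mE; field; rewrite d_neq0 q_neq0.
by rewrite de_Moivre angleE.
Qed.

(** * Grouping roots of unity by their order *)

(** The pairs (d, j) with d | m and j <= d coprime to d parametrize 1, ..., m
    by l = (m/d) j: then gcd(l, m) = m/d, so l determines d, hence j. *)
Lemma big_nat_by_gcd (T : Type) (idx : T) (op : Monoid.com_law idx)
    (m : nat) (f : nat -> T) : (0 < m)%N ->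
  \big[op/idx]_(1 <= l < m.+1) f l
    = \big[op/idx]_(d <- divisors m)
        \big[op/idx]_(1 <= l < d.+1 | coprime l d) f (m %/ d * l)%N.
Proof.
move=> m_gt0.
transitivity (\big[op/idx]_(l <- [seq (m %/ d * j)%N | d <- divisors m,
    j <- [seq j <- index_iota 1 d.+1 | coprime j d]]) f l); last first.
  by rewrite big_allpairs_dep; apply: eq_bigr => d _; rewrite big_filter.
apply: perm_big; apply: uniq_perm; first exact: iota_uniq.
  apply: allpairs_uniq_dep => [|d _|]; first exact: divisors_uniq.
    by rewrite filter_uniq ?iota_uniq.
  move=> _ _ /allpairsPdep[d [l [d_m + ->]]] /allpairsPdep[e [j [e_m + ->]]] /=.
  move: d_m e_m; rewrite -!(dvdn_divisors _ m_gt0) => d_m e_m.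
  rewrite !mem_filter => /andP[co_j _] /andP[co_l _] eq_lj.
  have gcdE c i : (c %| m)%N -> coprime i c -> gcdn (m %/ c * i) m = (m %/ c)%N.
    move=> c_m co.
    by rewrite -[X in gcdn _ X](divnK c_m) -muln_gcdr (eqP co) muln1.
  have q_eq : (m %/ d = m %/ e)%N by rewrite -(gcdE d l) // eq_lj gcdE.
  have q_gt0 : (0 < m %/ e)%N.
    by rewrite divn_gt0 ?(dvdn_gt0 m_gt0 e_m) // dvdn_leq.
  have de : d = e.
    by apply/eqP; rewrite -(eqn_pmul2l q_gt0) -{1}q_eq !divnK.
  move: eq_lj; rewrite de => /eqP; rewrite eqn_pmul2l // => /eqP -> //.
move=> l; rewrite mem_index_iota; apply/idP/allpairsPdep => [/andP[l_gt0 l_m]|].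
  have g_gt0 : (0 < gcdn l m)%N by rewrite gcdn_gt0 l_gt0.
  exists (m %/ gcdn l m)%N, (l %/ gcdn l m)%N; split.
  - by rewrite -(dvdn_divisors _ m_gt0) dvdn_div ?dvdn_gcdr.
  - rewrite mem_filter mem_index_iota ltnS leq_div2r // divn_gt0 //.
    rewrite dvdn_leq ?dvdn_gcdl //.
    rewrite /coprime -(eqn_pmul2r g_gt0) muln_gcdl.
    by rewrite !divnK ?dvdn_gcdl ?dvdn_gcdr ?mul1n ?eqxx.
  - by rewrite divnA ?dvdn_gcdr // mulKn // mulnC divnK ?dvdn_gcdl.
move=> [d [j [d_m + ->]]]; rewrite -(dvdn_divisors d m_gt0) in d_m.
rewrite mem_filter mem_index_iota ltnS => /and3P[_ j_gt0 le_jd].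
rewrite muln_gt0 j_gt0 divn_gt0 ?(dvdn_gt0 m_gt0 d_m) // dvdn_leq //= ltnS.
by rewrite -[X in (_ <= X)%N](divnK d_m) leq_mul2l le_jd orbT.
Qed.

Lemma big_zeta_by_order (R : realType) (T : Type) (idx : T)
    (op : Monoid.com_law idx) (m : nat) (f : R[i] -> T) : (0 < m)%N ->
  \big[op/idx]_(d <- divisors m)
      \big[op/idx]_(1 <= l < d.+1 | coprime l d) f (zeta R d ^+ l)
    = \big[op/idx]_(1 <= l < m.+1) f (zeta R m ^+ l).
Proof.
move=> m_gt0; rewrite (big_nat_by_gcd op (fun l => f (zeta R m ^+ l)) m_gt0).
apply: eq_big_seq => d; rewrite -(dvdn_divisors d m_gt0) => d_m.
by apply: eq_bigr => l _; rewrite exprM zeta_dvd.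
Qed.

(** * Integrality of A_m *)

(** Euclidean division of p by the monic q commutes with the embedding of Z, by
    uniqueness of quotient and remainder; the quotient found over F is thus the
    image of the one found over Z. *)
Lemma map_poly_int_divisor (F : numFieldType) (p q : {poly int})
    (B : {poly F}) :
  q \is monic -> B * map_poly intr q = map_poly intr p ->
  exists P : {poly int}, map_poly intr P = B.
Proof.
move=> q_monic defp; exists (Pdiv.Ring.rdivp p q).
have q'_monic : map_poly intr q \is @monic F by apply: monic_map.
have pE := Pdiv.RingMonic.rdivp_eq q_monic p.
have size_r : (size (map_poly intr (Pdiv.Ring.rmodp p q) : {poly F})
                < size (map_poly intr q : {poly F}))%N.
  rewrite !(size_map_inj_poly (@intr_inj F)) //.
  by rewrite Pdiv.Ring.ltn_rmodp monic_neq0.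
have := Pdiv.RingMonic.rdivp_addl_mul_small q'_monic
  (map_poly intr (Pdiv.Ring.rdivp p q)) size_r.
rewrite -rmorphM -rmorphD -pE /= -defp => <-.
exact: (Pdiv.RingMonic.rdivp_mull q'_monic).
Qed.

(** The homogenized form of the factorization of X^m - 1: for a != 0, multiply
    the latter by a^m after the substitution X = p / a. *)
Lemma prod_sub_scaled_roots (F : fieldType) (z a : F) (m : nat) (p : {poly F}) :
  m.-primitive_root z ->
  \prod_(1 <= l < m.+1) (p - (a * z ^+ l)%:P) = p ^+ m - (a ^+ m)%:P.
Proof.
move=> z_prim; have [->|a_neq0] := eqVneq a 0.
  rewrite expr0n eqn0Ngt (prim_order_gt0 z_prim) subr0.
  under eq_bigr do rewrite mul0r subr0.
  by rewrite prodr_const_nat subSS subn0.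
have rootsE : \prod_(1 <= l < m.+1) ('X - (z ^+ l)%:P) = 'X^m - 1.
  (* The factor for l = m takes the place of the one for l = 0. *)
  rewrite -(factor_Xn_sub_1 z_prim) big_add1 /=.
  case: m z_prim => [|m] z_prim; first by rewrite !big_nil.
  rewrite big_nat_recr //= [RHS]big_nat_recl //=.
  by rewrite (prim_expr_order z_prim) mulrC expr0.
have /(congr1 (fun q => (a ^+ m)%:P * (q \Po (a^-1 *: p)))) := rootsE.
rewrite rmorph_prod rmorphB rmorph1 /=.
have -> : 'X^m \Po (a^-1 *: p) = a^-1 ^+ m *: p ^+ m.
  by rewrite rmorphXn /= comp_polyX exprZn.
rewrite mulrBr mulr1 [_ * (_ *: _)]mul_polyC scalerA -exprMn mulfV // expr1n.
rewrite scale1r => <-.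
rewrite rmorphXn /=; have -> : a%:P ^+ m = \prod_(1 <= l < m.+1) a%:P.
  by rewrite prodr_const_nat subSS subn0.
rewrite -big_split; apply: eq_bigr => l _ /=.
rewrite comp_polyB comp_polyX comp_polyC mulrBr mul_polyC scalerA mulfV //.
by rewrite scale1r polyCM.
Qed.

Lemma prod_A_divisors (R : realType) (a : int) (m : nat) :
  (0 < m)%N ->
  \prod_(d <- divisors m) A R a d = ('X - 1) ^+ m - (a%:~R ^+ m)%:P.
Proof.
move=> m_gt0.
rewrite (big_zeta_by_order _ (fun w => 'X - 1 - (a%:~R * w)%:P) m_gt0).
exact/prod_sub_scaled_roots/zeta_prim_root.
Qed.

Lemma A_factors (R : realType) (a : int) (m : nat) :
  A R a m = \prod_(l <- [seq l <- index_iota 1 m.+1 | coprime l m])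
              ('X - (1 + a%:~R * zeta R m ^+ l)%:P).
Proof.
by rewrite big_filter; apply: eq_bigr => l _; rewrite polyCD opprD addrA.
Qed.

Lemma A_monic (R : realType) (a : int) (m : nat) : A R a m \is monic.
Proof. by rewrite A_factors monic_prod_XsubC. Qed.

Lemma size_A (R : realType) (a : int) (m : nat) :
  (0 < m)%N -> size (A R a m) = (totient m).+1.
Proof.
move=> m_gt0; rewrite A_factors size_prod_XsubC size_filter.
rewrite totient_count_coprime.
(* Here l ranges over 1, ..., m, whereas the totient counts 0, ..., m - 1; the
   endpoints 0 and m have the same gcd with m. *)
congr _.+1; rewrite -sum1_count big_mkcond big_add1 /=.
case: m m_gt0 => // m _.
rewrite big_nat_recr //= [RHS]big_nat_recl //= addnC.
congr (_ + _)%N; first by rewrite /coprime gcdn0 gcdnn; case: (_ == _).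
by apply: eq_bigr => l _; rewrite coprime_sym; case: coprime.
Qed.

Lemma A_integral (R : realType) (a : int) (m : nat) :
  (0 < m)%N -> exists P : {poly int}, map_poly intr P = A R a m.
Proof.
elim/ltn_ind: m => m IHm m_gt0.
have m_m : m \in divisors m by rewrite divisors_id.
have := prod_A_divisors R a m_gt0.
rewrite (big_rem m m_m) /=; set B := \prod_(d <- _) _ => defB.
have [Q mapQ] : exists Q : {poly int}, map_poly intr Q = B.
  rewrite /B big_seq; elim/big_ind: _ => [|_ _ [p <-] [q <-]|d].
  - by exists 1; rewrite rmorph1.
  - by exists (p * q); rewrite rmorphM.
  - rewrite mem_rem_uniq ?divisors_uniq // inE -(dvdn_divisors d m_gt0).
    move=> /andP[ne_dm d_m]; apply: IHm; last exact: dvdn_gt0 d_m.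
    by rewrite ltn_neqAle ne_dm dvdn_leq.
have Q_monic : Q \is monic.
  have : B \is monic by apply: monic_prod => d _; apply: A_monic.
  rewrite -mapQ !monicE -(rmorph1 (intr : int -> R[i])) lead_coef_map_inj //.
    by rewrite eqr_int.
  exact: intr_inj.
apply: (@map_poly_int_divisor _ (('X - 1) ^+ m - (a ^+ m)%:P) Q) => //.
rewrite mapQ defB [RHS]rmorphB /= [in RHS]rmorphXn /= [in RHS]rmorphB /=.
by rewrite rmorph1 map_polyX map_polyC /= [in RHS]rmorphXn.
Qed.

(** * The recurrence and the roots-of-unity filter *)

Lemma A_recurrence (R : realType) (a : int) (m n : nat) (k : int) :
  \sum_(s < size (A R a m)) (A R a m)`_s * W R a (n + s) k m = 0.
Proof.
under eq_bigr do rewrite /W mulr_sumr.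
rewrite exchange_big /= big1_seq // => l /andP[co_l l_m].
set x := 1 + a%:~R * zeta R m ^+ l; set c := zeta R m ^ _.
transitivity (c * x ^+ n * (A R a m).[x]).
  rewrite horner_coef mulr_sumr; apply: eq_bigr => s _.
  by rewrite exprD; ring.
apply/eqP; rewrite mulf_eq0; apply/orP; right.
pose f j := 1 + a%:~R * zeta R m ^+ j.
rewrite A_factors -(big_map f predT (fun y => 'X - y%:P)) -/(root _ x).
by rewrite root_prod_XsubC (map_f f) // mem_filter co_l.
Qed.

Lemma primroot_neq0 (F : fieldType) (z : F) (m : nat) :
  m.-primitive_root z -> z != 0.
Proof.
move=> z_prim; apply/eqP=> z0; have := prim_expr_order z_prim.
rewrite z0 expr0n eqn0Ngt (prim_order_gt0 z_prim) => /eqP.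
by rewrite eq_sym oner_eq0.
Qed.

(** For w = z^j, the sum of the w^l is m if w = 1; otherwise it is killed by
    w - 1, as w^m = 1. *)
Lemma sum_prim_root_exp (F : fieldType) (z : F) (m : nat) (j : int) :
  m.-primitive_root z ->
  \sum_(1 <= l < m.+1) (z ^+ l) ^ j = if (m%:Z %| j)%Z then m%:R else 0.
Proof.
move=> z_prim; have m_gt0 := prim_order_gt0 z_prim.
have z_neq0 := primroot_neq0 z_prim.
have termE l : (z ^+ l) ^ j = (z ^ j) ^+ l by rewrite !exprnP exprzAC.
under eq_bigr do rewrite termE.
have [n defn] : exists n : nat, (j %% m%:Z)%Z = n%:Z.
  by exists `|(j %% m%:Z)%Z|%N; rewrite gez0_abs // modz_ge0 // gt_eqF.
have zjE : z ^ j = z ^+ n.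
  rewrite [in LHS](divz_eq j m%:Z) expfzDr // defn [(_ * m%:Z)%R]mulrC.
  rewrite -exprz_exp.
  by rewrite -[z ^ m%:Z]exprnP (prim_expr_order z_prim) exp1rz mul1r.
have zj1 : (z ^ j == 1) = (m%:Z %| j)%Z.
  rewrite zjE -(prim_order_dvd z_prim).
  by rewrite [in RHS](divz_eq j m%:Z) defn rpredDl // dvdz_mull.
have zjm : (z ^ j) ^+ m = 1.
  by rewrite -!termE (prim_expr_order z_prim) exp1rz.
case: ifPn => [|]; rewrite -zj1.
  move/eqP => ->; under eq_bigr do rewrite expr1n.
  by rewrite sumr_const_nat subSS subn0.
rewrite -subr_eq0 => /mulfI; apply; rewrite mulr0 big_add1 big_mkord /=.
under eq_bigr do rewrite exprS.
by rewrite -mulr_sumr mulrCA -subrX1 zjm subrr mulr0.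
Qed.

(** Expand the n-th power and exchange the sums; the inner sum over l, for the
    exponent k - r, is the filter of [sum_prim_root_exp]. *)
Lemma binom_res_sumE (R : realType) (a : int) (m n : nat) (r : int) :
  (0 < m)%N ->
  (binom_res_sum n r m a)%:~R * m%:R
    = \sum_(1 <= l < m.+1)
        (zeta R m ^+ l) ^ (- r) * (1 + a%:~R * zeta R m ^+ l) ^+ n.
Proof.
move=> m_gt0; set z := zeta R m.
have z_prim : m.-primitive_root z by apply: zeta_prim_root.
have z_neq0 : z != 0 by apply: primroot_neq0 z_prim.
transitivity (\sum_(1 <= l < m.+1) \sum_(k < n.+1)
    ('C(n, k)%:R * a%:~R ^+ k) * (z ^+ l) ^ (k%:Z - r)); last first.
  apply: eq_bigr => l _; rewrite exprDn mulr_sumr.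
  apply: eq_bigr => k _; rewrite expr1n mul1r expfzDr ?expf_neq0 //.
  by rewrite exprMn -exprnP -[in RHS]mulr_natl; ring.
rewrite exchange_big /binom_res_sum big_mkord big_mkcond rmorph_sum.
rewrite mulr_suml /=.
apply: eq_bigr => k _; rewrite -mulr_sumr (sum_prim_root_exp _ z_prim).
rewrite eqz_mod_dvd; case: ifP => _; last by rewrite mul0r mulr0.
by rewrite rmorphM rmorphXn.
Qed.

Theorem theorem2p2 (R : realType) (a : int)
    (ha0 : a <> 0) (ha1 : a <> 1) (haN1 : a <> -1)
    (m n : nat) (hm : (0 < m)%N) (hn : (0 < n)%N) :
  [/\ A R a m = \sum_(s < (totient m).+1) (A R a m)`_s *: 'X^s,
      exists P : {poly int}, map_poly intr P = A R a m,
      forall k : int,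
        \sum_(s < (totient m).+1) (A R a m)`_s * W R a (n + s) k m = 0
    & forall r : int,
        (binom_res_sum n r m a)%:~R
          = (m%:R)^-1 * \sum_(d <- divisors m) W R a n r d].
Proof.
rewrite -(size_A R a hm); split.
- by rewrite -poly_def coefK.
- exact: A_integral.
- exact: A_recurrence.
- move=> r; have m_neq0 : m%:R != 0 :> R[i] by rewrite pnatr_eq0 -lt0n.
  apply: (mulIf m_neq0); rewrite mulrAC mulVf // mul1r binom_res_sumE //.
  rewrite -(big_zeta_by_order _
    (fun w => w ^ (- r) * (1 + a%:~R * w) ^+ n)) //.
  apply: eq_bigr => d _; apply: eq_bigr => l _.
  by congr (_ * _); rewrite exprnP exprz_exp mulrN mulrC.
Qed.
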